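(* Let $\lambda\in\{\mathsf{Ev},\mathsf{Ev}_\flat,\mathsf{Ev}_u,\mathsf{Ev}_{\flat u}\}$ and let $\mathcal M$ be a $\lambda$-model. Then there exists an evidence model $\mathcal N=\langle W^\triangledown,E^\triangledown,V^\triangledown\rangle$ such that $\mathcal M$ is a $p$-morphic image of $\mathcal N^\vartriangle$. Further, if $\mathcal M$ is (i) flat and finite, (ii) flat, (iii) uniform, or (iv) finite and concise, then $\mathcal N$ can be taken to be, respectively, (i) flat and finite, (ii) flat, (iii) uniform, or (iv) finite and concise.
   Context: MODELS. Fix a set $\mathsf{At}$ of atoms. An $EB\!\preccurlyeq$-model is $\mathcal M=\langle W,E,B,\preccurlyeq,V\rangle$ with $W\neq\varnothing$, $E\subseteq W\times\wp(W)$ (write $E(w)=\{X: w\,E\,X\}$), $B\subseteq W\times W$, $\preccurlyeq$ a reflexive transitive relation on $W$, $V:\mathsf{At}\to\wp(W)$, such that: (1) for all $w$, $\varnothing\notin E(w)$ and $W\in E(w)$; (2) if $w\preccurlyeq v$ and $w\in X\in E(u)$ then $v\in X$; (3) if $w\preccurlyeq v$ and $u\,B\,w$ then $u\,B\,v$. An evidence model is $\langle W,E,V\rangle$ with $W\ne\varnothing$, $E\subseteq W\times\wp(W)$, $V:\mathsf{At}\to\wp(W)$ satisfying (1). INTENDED MODELS. For an evidence model $\mathcal N=\langle W,E,V\rangle$: a $w$-scenario is a maximal (under inclusion) collection $\mathcal X\subseteq E(w)$ with the finite intersection property. $w\,B_E\,v$ iff $v\in\bigcap\mathcal X$ for some $w$-scenario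 $\mathcal X$. $w\preccurlyeq_E v$ iff for all $u,X$ with $w\in X\in E(u)$ we have $v\in X$. Put $\mathcal N^\vartriangle=\langle W,E,B_E,\preccurlyeq_E,V\rangle$. SPECIAL CLASSES. An $EB\!\preccurlyeq$-model is flat if whenever $w\,E\,X$ there is $v\in X$ with $w\,B\,v$. It is uniform if $E(w)$ and $\{v:w\,B\,v\}$ do not depend on $w$ (the latter set is then also denoted $B$) and every $v\in B$ is $\preccurlyeq$-maximal (i.e. $v\preccurlyeq u$ implies $u\preccurlyeq v$). It is concise if it is flat, uniform and every $\preccurlyeq$-maximal $w$ belongs to $B$. An evidence model $\mathcal N$ is flat, uniform or concise if $\mathcal N^\vartriangle$ is. ''$\lambda$-models'' are: all $EB\!\preccurlyeq$-models for $\lambda=\mathsf{Ev}$, flat ones for $\mathsf{Ev}_\flat$, uniform ones for $\mathsf{Ev}_u$, concise ones for $\mathsf{Ev}_{\flat u}$. (Here $\lambda$ serves only to name one of these four classes.) P-MORPHISMS. A $p$-morphism from $\langle W_1,E_1,B_1,\preccurlyeq_1,V_1\rangle$ to $\langle W_2,E_2,B_2,\preccurlyeq_2,V_2\rangle$ is $\pi:W_1\to W_2$ such that: $V_1(p)=\pi^{-1}[V_2(p)]$ for every $p\in\mathsf{At}$; for each $R\in\{B,\preccurlyeq\}$, $w\,R_1\,v$ implies $\pi(w)\,R_2\,\pi(v)$, and $\pi(w)\,R_2\,u$ implies there is $v\in\pi^{-1}(u)$ with $w\,R_1\,v$; if $w\,E_1\,X$ then there is $Y\subseteq W_2$ with $\pi(w)\,E_2\,Y$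 and $Y\subseteq\pi[X]$; if $\pi(w)\,E_2\,Y$ then there is $X$ with $w\,E_1\,X$ and $\pi[X]\subseteq Y$. $\mathcal M$ is a $p$-morphic image of $\mathcal N^\vartriangle$ if there is a surjective $p$-morphism from $\mathcal N^\vartriangle$ to $\mathcal M$. *)

(* Defs.v *)
From mathcomp Require Import all_boot finmap.
From mathcomp Require Import classical_sets functions cardinality filter.

Set Implicit Arguments.
Unset Strict Implicit.
Unset Printing Implicit Defensive.

Local Open Scope classical_set_scope.

(* [evid M w] is E(w), the set of the X with w E X. *)
Record evidence_model (At : Type) := EvidenceModel {
  world :> Type;
  evid : world -> set (set world);
  valuation : At -> set world;
  world_neq0 : [set: world] !=set0;
  evid_set0 : forall w, ~ evid w set0;
  evid_setT : forall w, evid w [set: world] }.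
Arguments evid {At} M w X : rename.
Arguments valuation {At} M p w : rename.

(* An EB-preorder model <W, E, B, <=, V>, as relations B and <= on an evidence
   model <W, E, V>; [bel M w] is the set of the v with w B v. *)
Record eb_model (At : Type) := EBModel {
  reduct :> evidence_model At;
  bel : reduct -> set reduct;
  pleq : reduct -> reduct -> Prop;
  pleq_refl : forall w, pleq w w;
  pleq_trans : forall w v u, pleq w v -> pleq v u -> pleq w u;
  pleq_evid : forall w v u X, pleq w v -> X w -> evid reduct u X -> X v;
  pleq_bel : forall w v u, pleq w v -> bel u w -> bel u v }.
Arguments bel {At} M w v : rename.
Arguments pleq {At} M w v : rename.

Section Intended.
Variables (At : Type) (N : evidence_model At).

Definition scenario (w : N) (XX : set (set N)) : Prop :=
  [/\ XX `<=` evid N w, finI XX id &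
      forall YY : set (set N),
        YY `<=` evid N w -> finI YY id -> XX `<=` YY -> YY = XX].

Definition bel_E (w : N) : set N :=
  [set v | exists2 XX, scenario w XX & (\bigcap_(X in XX) X) v].

Definition pleq_E (w v : N) : Prop :=
  forall (u : N) (X : set N), X w -> evid N u X -> X v.

Fact pleq_E_refl w : pleq_E w w.
Proof. by []. Qed.

Fact pleq_E_trans w v u : pleq_E w v -> pleq_E v u -> pleq_E w u.
Proof. by move=> wv vu t X Xw tX; apply: (vu t) => //; apply: (wv t). Qed.

Fact pleq_E_evid w v u (X : set N) : pleq_E w v -> X w -> evid N u X -> X v.
Proof. by move=> wv; apply: wv. Qed.

Fact pleq_E_bel w v u : pleq_E w v -> bel_E u w -> bel_E u v.
Proof.
move=> wv [XX sXX XXw]; exists XX => // X XXX; apply: (wv u); first exact: XXw.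
by case: sXX => + _ _; apply.
Qed.

Definition intended : eb_model At :=
  EBModel pleq_E_refl pleq_E_trans pleq_E_evid pleq_E_bel.

End Intended.

Section Classes.
Variables (At : Type) (M : eb_model At).

Definition flat : Prop :=
  forall (w : M) (X : set M), evid M w X -> exists2 v, X v & bel M w v.

(* [premaximal (pleq M) v] says that v <= u implies u <= v for all u. *)
Definition uniform : Prop :=
  [/\ forall w w' : M, evid M w = evid M w',
      forall w w' : M, bel M w = bel M w' &
      forall w v : M, bel M w v -> premaximal (pleq M) v].

(* Under [uniform], membership in the common value B of the sets [bel M w] is
   membership in [bel M w] for all w. *)
Definition concise : Prop :=
  [/\ flat, uniform &
      forall v : M, premaximal (pleq M) v -> forall w : M, bel M w v].

End Classes.

Definition finite_model (At : Type) (N : evidence_model At) : Prop :=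
  finite_set [set: N].

Inductive logic := Ev | Ev_flat | Ev_u | Ev_flat_u.

Definition lambda_model (lambda : logic) (At : Type) (M : eb_model At) : Prop :=
  match lambda with
  | Ev => True
  | Ev_flat => flat M
  | Ev_u => uniform M
  | Ev_flat_u => concise M
  end.

Section PMorphisms.
Variable At : Type.

Definition back_and_forth (T1 T2 : Type) (f : T1 -> T2)
    (R1 : T1 -> T1 -> Prop) (R2 : T2 -> T2 -> Prop) : Prop :=
  (forall w v, R1 w v -> R2 (f w) (f v)) /\
  (forall w u, R2 (f w) u -> exists2 v, f v = u & R1 w v).

Definition pmorphism (M1 M2 : eb_model At) (f : M1 -> M2) : Prop :=
  [/\ forall p : At, valuation M1 p = f @^-1` valuation M2 p,
      back_and_forth f (bel M1) (bel M2),
      back_and_forth f (pleq M1) (pleq M2),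
      forall (w : M1) (X : set M1), evid M1 w X ->
        exists2 Y : set M2, evid M2 (f w) Y & Y `<=` f @` X &
      forall (w : M1) (Y : set M2), evid M2 (f w) Y ->
        exists2 X : set M1, evid M1 w X & f @` X `<=` Y].

(* M2 is a p-morphic image of M1. *)
Definition pmorphic_image (M2 M1 : eb_model At) : Prop :=
  exists2 f : M1 -> M2, pmorphism f & set_surj [set: M1] [set: M2] f.

End PMorphisms.

(* Main.v *)
Require Import Defs.
From mathcomp Require Import all_boot finmap.
From mathcomp Require Import boolp classical_sets functions cardinality filter.

Set Implicit Arguments.
Unset Strict Implicit.
Unset Printing Implicit Defensive.

Local Open Scope classical_set_scope.

(** In all cases [N] has worlds [M * L] for some set [L] of layers, and the
    p-morphism is the first projection.  Evidence is made of sets closed under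
    the order of [M] inside each layer, so the intended order contains the
    order of [M] layerwise; if moreover there is evidence through [(x, l)] that
    misses [(y, l')] for all [y] not above [x], the projection preserves the
    intended order, and only belief remains ([layered_pmorphic]).

    Belief is governed by [bel_EP]: [w] believes [v] iff each evidence of [w]
    that omits [v] is disjoint from a finite intersection of evidence of [w]
    through [v].  To make [w] believe in a point over [b], it is given two
    pieces of evidence that meet only in a cone of [b], called a core, inside
    one layer ([bel_E_prong]).  Each piece also contains full layers: its
    projection is then [M], which is always evidence in [M].  The constructions
    differ in how they prevent further beliefs.

    - If [M] is concise, the believed points are the maximal ones.  Take all
      closed sets whose projection contains evidence: evidence through a point
      lies in the evidence through any point above it, so belief forces
      maximality, and the two prongs make every maximal point believed.

    - If [M] is flat, every world [w] has beliefs, so each nontrivial evidence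
      of [w] can be attached to the core of a believed world, with evidence
      attached to distinct cores disjoint.  Then the scenarios of [w] are given
      by the cores.  Finitely many layers per core suffice.

    - In general the intersection of a scenario may have to be empty.  Layers
      now carry a natural number, and evidence contains, with each point outside
      the cores, its copies in all late layers (of one parity, for the prongs).
      A finite intersection of evidence through a point over a world that is not
      believed thus contains late points, so it meets every tail; some tails
      omit the point, hence it is not believed either. If cores of distinct
      beliefs never meet unless they coincide, the prongs do their job.
      Disjointness is achieved by putting the cores in distinct layers; when [M]
      is uniform it holds within a single layer, since the cones of believed
      worlds are clusters, and then the evidence does not depend on the world. *)

(** * Belief in evidence models *)

Section BelE.
Variables (At : Type) (N : evidence_model At).
Implicit Types (w v q : N) (S R : set N).

(** A scenario whose intersection contains [v] must consist of all the evidence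
    through [v], so belief in [v] says that this family is maximal: whatever it
    omits is disjoint from one of its finite intersections. *)
Lemma bel_EP w v :
  bel_E w v <->
  forall S, evid N w S -> ~ S v ->
    exists2 F : {fset set N}, (forall R, R \in F -> evid N w R /\ R v) &
      forall q, S q -> exists2 R, R \in F & ~ R q.
Proof.
split=> [[XX [XXw _ maxXX] XXv] S wS nSv|H].
  apply: contrapT => noF; apply: nSv; apply: (XXv).
  suff <- : [set R | XX R \/ R = S] = XX by right.
  apply: maxXX => [R [/XXw//|->//]|F sF|R XR]; last by left.
  apply: contrapT => F0; apply: noF; exists (F `\ S)%fset => [R|q Sq].
    rewrite !inE => /andP[/eqP RS /sF]; rewrite inE => -[XR|//].
    by split; [exact: XXw|exact: XXv].
  apply: contrapT => nq; apply: F0; exists q => R /= RF.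
  have [->//|/eqP RS] := pselect (R = S).
  by apply: contrapT => nRq; apply: nq; exists R => //; rewrite !inE RS.
exists [set R | evid N w R /\ R v]; last by move=> R [].
split=> [R []//|F sF|YY YYw finYY sYY].
  by exists v => R /= /sF; rewrite inE => -[].
apply/seteqP; split=> // S YS; split; first exact: YYw.
apply: contrapT => nSv; have [F FP Fq] := H S (YYw _ YS) nSv.
have [|q qP] := finYY (S |` F)%fset.
  move=> R; rewrite !inE => /orP[/eqP->//|/FP[wR Rv]].
  by apply: sYY.
have Sq : S q by apply: qP => /=; rewrite !inE eqxx.
by have [R RF] := Fq q Sq; apply; apply: qP => /=; rewrite !inE RF orbT.
Qed.

(** By the finite intersection property: a point [q] that lies in all the
    evidence through [v] would witness that [S] is compatible with it. *)
Lemma bel_E_closed w v S q : bel_E w v -> evid N w S -> S q ->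
  (forall R, evid N w R -> R v -> R q) -> S v.
Proof.
move=> /bel_EP vP wS Sq vq; apply: contrapT => nSv.
have [F FP Fq] := vP S wS nSv.
by have [R /FP[wR Rv]] := Fq q Sq; apply; apply: vq.
Qed.

Lemma bel_E_pair w v R1 R2 : evid N w R1 -> evid N w R2 -> R1 v -> R2 v ->
  (forall S q, evid N w S -> S q -> R1 q -> R2 q -> S v) -> bel_E w v.
Proof.
move=> wR1 wR2 R1v R2v vP; apply/bel_EP => S wS nSv.
exists [fset R1; R2]%fset => [R|q Sq].
  by rewrite !inE => /orP[]/eqP->.
apply: contrapT => nq; apply: nSv; apply: (vP S q) => //.
  by apply: contrapT => nR; apply: nq; exists R1; rewrite // !inE eqxx.
by apply: contrapT => nR; apply: nq; exists R2; rewrite // !inE eqxx orbT.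
Qed.

End BelE.

(** * Layered models *)

Section Layered.
Variables (At : Type) (M : eb_model At) (L : Type).
Implicit Types (x y b : M) (l k : L) (p q : M * L) (S : set (M * L)).

Definition up_closed S := forall x y l, pleq M x y -> S (x, l) -> S (y, l).

(** Separates [(x, l)] from [(y, l')] for all [y] not above [x].  Only the layers
    [l] and [l'] are constrained, so the projection is everything as soon as a
    third layer exists. *)
Definition above_at x l l' : set (M * L) :=
  [set q | q.2 = l \/ q.2 = l' -> pleq M x q.1].

(** Two prongs with disjoint [P] meet in a core, the cone of [b] in layer [k],
    while each still projects onto [M] if [P] is nonempty. *)
Definition prong b k (P : set L) : set (M * L) :=
  [set q | q.2 = k /\ pleq M b q.1 \/ P q.2].

Lemma above_at_up x l l' : up_closed (above_at x l l').
Proof. by move=> y z m yz Sy /Sy /pleq_trans; apply. Qed.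

Lemma prong_up b k P : up_closed (prong b k P).
Proof.
move=> y z m yz [[/= mk by_]|Pm]; [left|by right].
by split=> //; apply: pleq_trans yz.
Qed.

Lemma full_image S : (forall x, exists l, S (x, l)) -> fst @` S = [set: M].
Proof.
by move=> fS; apply/seteqP; split=> // x _; have [l] := fS x; exists (x, l).
Qed.

Section Model.
Variables (l0 : L) (ev : M * L -> set (set (M * L))).
Hypothesis ev_setT : forall p, ev p setT.
Hypothesis ev_img : forall p S, ev p S ->
  exists2 Y, evid M p.1 Y & Y `<=` fst @` S.

Lemma layered_neq0 : [set: M * L] !=set0.
Proof. by have [x _] := world_neq0 M; exists (x, l0). Qed.

Lemma layered_set0 p : ~ ev p set0.
Proof.
move=> /ev_img[Y pY Y0]; apply: (evid_set0 (e := M) (w := p.1)).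
by suff <- : Y = set0 by []; apply/seteqP; split=> // x /Y0[].
Qed.

Definition layered : evidence_model At :=
  EvidenceModel (fun a => fst @^-1` valuation M a)
    layered_neq0 layered_set0 ev_setT.

Lemma layered_finite : finite_set [set: L] -> finite_model M ->
  finite_model layered.
Proof. by move=> fL fM; rewrite /finite_model -setXTT; apply: finite_setX. Qed.

(** The last premise says that evidence meeting the core contains its root
    [(b, k)]; so evidence that omits the root is disjoint from the intersection
    of the two prongs. *)
Lemma bel_E_prong (p : layered) b k P P' :
    ev p (prong b k P) -> ev p (prong b k P') -> P `&` P' `<=` set0 ->
    (forall S y, ev p S -> S (y, k) -> pleq M b y -> S (b, k)) ->
  bel_E p ((b, k) : layered).
Proof.
move=> pP pP' PP' core; apply: (@bel_E_pair _ layered _ _ _ _ pP pP').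
- by left; split=> //; apply: pleq_refl.
- by left; split=> //; apply: pleq_refl.
move=> S [y l] pS Sy P1 P2.
suff [/= lk by_] : l = k /\ pleq M b y by apply: (core S y); rewrite -?lk.
by case: P1 => // P1; case: P2 => // P2; case: (PP' l).
Qed.

Hypothesis ev_up : forall p S, ev p S -> up_closed S.

Lemma layered_pleq (p q : layered) :
  pleq M p.1 q.1 -> p.2 = q.2 -> pleq_E p q.
Proof.
by case: p q => [x l] [y l'] /= xy <- u X Xx uX; apply: (ev_up uX) Xx.
Qed.

Hypothesis ev_sep : forall x l l', exists p,
  exists2 S, ev p S /\ S (x, l) & S `<=` above_at x l l'.

Lemma layered_pleq_fst (p q : layered) : pleq_E p q -> pleq M p.1 q.1.
Proof.
move=> pq; have [u [S [uS Sp] Sabove]] := ev_sep p.1 p.2 q.2.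
by apply: (Sabove q); [apply: pq uS; case: (p) Sp|right].
Qed.

Hypothesis bel_forth : forall p q : layered, bel_E p q -> bel M p.1 q.1.

(** Evidence omitting a single layer confines the intended order to layers, so
    a point above a believed [q] lies over a world equivalent to that of [q],
    in the same layer. *)
Lemma layered_uniform :
    (forall l, exists p, ev p [set q | q.2 <> l]) ->
    (forall p q, ev p = ev q) ->
  uniform M -> uniform (intended layered).
Proof.
move=> ev_layer ev_const [_ _ maxM].
split=> [|p q|p q pq u qu]; first exact: ev_const.
  by rewrite /= /bel_E /scenario /= (ev_const p q).
have qu2 : q.2 = u.2.
  apply: contrapT => neq; have [t tu] := ev_layer u.2.
  exact: (qu t _ neq tu).
apply: layered_pleq => //.
exact: maxM (bel_forth pq) _ (layered_pleq_fst qu).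
Qed.

Hypothesis ev_back : forall p Y, evid M p.1 Y ->
  exists2 S, ev p S & fst @` S `<=` Y.
Hypothesis bel_back : forall (p : layered) x, bel M p.1 x ->
  exists l, bel_E p ((x, l) : layered).

Lemma layered_pmorphic : pmorphic_image M (intended layered).
Proof.
exists fst => /=; last by move=> x _; exists (x, l0).
split=> //; split=> [p q|p x].
- exact: bel_forth.
- by move=> /bel_back[l pl]; exists (x, l).
- exact: layered_pleq_fst.
- by move=> px; exists (x, p.2) => //; apply: layered_pleq.
Qed.

End Model.
End Layered.

(** * Finitely many layers *)

Definition layer4 : Type := bool * bool.

(** Four layers, as the separating sets below treat up to three specially. *)
Lemma fresh_layer (i j k : layer4) : exists l, [/\ l <> i, l <> j & l <> k].
Proof.
have /allPn[l _] : ~~ all [in [:: i; j; k]] (enum {: bool * bool}).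
  apply/negP => /allP /(uniq_leq_size (enum_uniq _)).
  by rewrite -cardE card_prod card_bool.
by rewrite !inE !negb_or => /and3P[/eqP ? /eqP ? /eqP ?]; exists l.
Qed.

Lemma finite_layer4 : finite_set [set: layer4].
Proof. exact: (@finite_finset (bool * bool)%type). Qed.

(** * Concise models *)

Section Concise.
Variables (At : Type) (M : eb_model At).
Hypothesis cM : concise M.

(** All the evidence that the projection allows; it depends on [p] only through
    [evid M p.1], which keeps the model uniform. *)
Definition image_evid (p : M * layer4) (S : set (M * layer4)) : Prop :=
  up_closed S /\ exists2 Y, evid M p.1 Y & Y `<=` fst @` S.

Lemma image_evid_full p S : up_closed S -> (forall x, exists l, S (x, l)) ->
  image_evid p S.
Proof.
move=> uS /full_image iS; split=> //; exists setT; rewrite ?iS //.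
exact: evid_setT.
Qed.

Lemma image_evid_setT p : image_evid p setT.
Proof. by apply: image_evid_full => // x; exists (true, true). Qed.

Definition concise_layered : evidence_model At :=
  layered (true, true) image_evid_setT (fun p S => @proj2 _ _).
Local Notation N := concise_layered.

Lemma image_evid_sep x l l' : exists p,
  exists2 S, image_evid p S /\ S (x, l) & S `<=` above_at x l l'.
Proof.
exists (x, l), (above_at x l l') => //.
split; last by move=> _; apply: pleq_refl.
apply: image_evid_full => [|y]; first exact: above_at_up.
by have [k [kl kl' _]] := fresh_layer l l' l'; exists k => -[].
Qed.

Lemma image_evid_layer l : exists p, image_evid p [set q | q.2 <> l].
Proof.
have [x _] := world_neq0 M; exists (x, l); apply: image_evid_full => // y.
by have [k [kl _ _]] := fresh_layer l l l; exists k.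
Qed.

Lemma image_evid_const p q : image_evid p = image_evid q.
Proof.
by have [_ [evM _ _] _] := cM; rewrite /image_evid (evM p.1 q.1).
Qed.

(** If [y] is above [x], evidence through [(x, k)] passes through [(y, k)],
    so evidence separating [(y, k)] from [(x, k)] could be added to the
    scenario; hence [y] is below [x], and maximal worlds are believed. *)
Lemma concise_bel_forth (p q : N) : bel_E p q -> bel M p.1 q.1.
Proof.
have [_ _ maxM] := cM; case: q => x k pq; apply: (maxM) => y xy.
have [u [S [uS Sy] Sabove]] := image_evid_sep y k k.
apply: (Sabove (x, k)); last by left.
apply: (@bel_E_closed _ N p (x, k) S (y, k) pq) => //.
  by rewrite /= (image_evid_const p u).
by move=> R [upR _]; apply: upR.
Qed.

(** Maximality of [x] makes its cone a cluster, so closed sets meeting the core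
    contain its root. *)
Lemma concise_bel_back (p : N) x k : bel M p.1 x -> bel_E p ((x, k) : N).
Proof.
have [_ [_ _ maxM] _] := cM => /maxM x_max.
have [i [ik _ _]] := fresh_layer k k k.
have [j [jk ji _]] := fresh_layer k i i.
have prong_evid l : image_evid p (prong x k [set l]).
  apply: image_evid_full => [|y]; first exact: prong_up.
  by exists l; right.
apply: (bel_E_prong (prong_evid i) (prong_evid j)) => [l [-> /esym]//|S y].
by move=> [upS _] Sy /x_max yx; apply: upS Sy.
Qed.

Lemma concise_pmorphic : pmorphic_image M (intended N).
Proof.
apply: layered_pmorphic => [p S []//||||p x].
- exact: image_evid_sep.
- exact: concise_bel_forth.
- move=> p Y pY; exists [set q | Y q.1]; last by move=> _ [q Yq <-].
  split=> [x y l xy Yx|]; first exact: (pleq_evid xy Yx pY).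
  by exists Y => // x Yx; exists (x, p.2).
- by exists p.2; apply: concise_bel_back.
Qed.

Lemma concise_concise : concise (intended N).
Proof.
have [flatM uniM maxM] := cM; split.
- move=> p S [upS [Y pY YS]]; have [_ /YS[[x l] Sx <-] px] := flatM _ _ pY.
  by exists (x, l) => //; apply: concise_bel_back.
- apply: layered_uniform => //; first by move=> p S [].
  + exact: image_evid_sep.
  + exact: concise_bel_forth.
  + exact: image_evid_layer.
  + exact: image_evid_const.
- move=> [x l] x_max p; apply: concise_bel_back; apply: maxM => y xy.
  suff /(layered_pleq_fst image_evid_sep) : pleq_E (N := N) (y, l) (x, l) by [].
  by apply: x_max; apply: layered_pleq => // q S [].
Qed.

End Concise.

(** * Flat models *)

Section Flat.
Variables (At : Type) (M : eb_model At).
Hypothesis flatM : flat M.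
(* [r w] retracts [M] onto the worlds believed by [w], so that every [c] can index
   evidence of every [w]: the sets used to separate points over any [c] are
   then available at all worlds. *)
Variable r : M -> M -> M.
Hypothesis r_bel : forall w c, bel M w (r w c).
Hypothesis r_id : forall w c, bel M w c -> r w c = c.

Local Notation W := (M * (M * layer4))%type.

(** Layers are pairs of an index [c] and one of four copies.  At the world [p]
    the copy [p.2.2] is reserved for the cores, and evidence of type [c] meets
    it exactly in the core of [r p.1 c].  Two points can be separated at worlds
    whose reserved copy is neither of theirs. *)
Definition typed (p : W) (c : M) (S : set W) : Prop :=
  [/\ up_closed S, forall q, S q -> q.2.1 = c,
      forall x, S (x, (c, p.2.2)) <-> pleq M (r p.1 c) x &
      exists2 Y, evid M p.1 Y & Y `<=` fst @` S].

Definition flat_evid (p : W) (S : set W) : Prop :=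
  S = setT \/ exists c, typed p c S.

Lemma typed_full p c S : up_closed S -> (forall q, S q -> q.2.1 = c) ->
  (forall x, S (x, (c, p.2.2)) <-> pleq M (r p.1 c) x) ->
  (forall x, exists l, S (x, l)) -> flat_evid p S.
Proof.
move=> uS Sc Sr /full_image iS; right; exists c; split=> //.
by exists setT; rewrite ?iS //; apply: evid_setT.
Qed.

Lemma flat_evid_setT p : flat_evid p setT. Proof. by left. Qed.

Lemma flat_evid_img p S : flat_evid p S ->
  exists2 Y, evid M p.1 Y & Y `<=` fst @` S.
Proof.
case=> [->|[c []//]]; exists setT; first exact: evid_setT.
by move=> x _; exists (x, p.2).
Qed.

Lemma flat_evid_up p S : flat_evid p S -> up_closed S.
Proof. by case=> [->|[c []]]. Qed.

Definition flat_layered (x0 : M) : evidence_model At :=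
  layered (x0, (true, true)) flat_evid_setT flat_evid_img.

Lemma flat_evid_sep x l l' : exists p,
  exists2 S, flat_evid p S /\ S (x, l) & S `<=` above_at x l l'.
Proof.
case: l l' => [c i] [c' i']; have [k [ki ki' _]] := fresh_layer i i' i'.
have [j [ji ji' jk]] := fresh_layer i i' k.
exists (x, (c, k)), (above_at x (c, i) (c', i') `&`
  [set q | q.2.1 = c /\ (q.2.2 = k -> pleq M (r x c) q.1)]).
  split; last by split; [move=> _; apply: pleq_refl|split=> //= /esym].
  apply: (@typed_full _ c) => /=.
  - move=> y z m yz [Sy [mc yr]]; split; first exact: above_at_up yz Sy.
    by split=> // /yr /pleq_trans; apply.
  - by move=> q [_ []].
  - move=> y; split=> [[_ [_]]|ry]; first exact.
    by split=> //= -[] [].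
  - by move=> y; exists (c, j); split=> //= -[] [].
by move=> q [].
Qed.

Definition arm4 (p : W) c j := prong (r p.1 c) (c, p.2.2) [set (c, j)].

Lemma arm4_evid p c j : j <> p.2.2 -> flat_evid p (arm4 p c j).
Proof.
move=> jk; apply: (@typed_full _ c) => /=.
- exact: prong_up.
- by move=> [y l] [[/= -> _]|/= ->].
- by move=> y; split=> [[[]//|/= [/esym]//]|ry]; left.
- by move=> y; exists (c, j); right.
Qed.

Section Bel.
Variable x0 : M.
Local Notation N := (flat_layered x0).

(** Evidence meeting the core of type [c] is trivial or of type [c], so it
    contains the whole core. *)
Lemma flat_bel_core (p : N) c : bel_E p ((r p.1 c, (c, p.2.2)) : N).
Proof.
have [i [ik _ _]] := fresh_layer p.2.2 p.2.2 p.2.2.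
have [j [jk ji _]] := fresh_layer p.2.2 i i.
apply: (bel_E_prong (arm4_evid c ik) (arm4_evid c jk)).
  by move=> l [-> [/esym]].
move=> S y [->//|[c' [_ Sc Sr _]]] Sy _.
by move: (Sc _ Sy) Sr => /= <- Sr; apply/Sr; apply: pleq_refl.
Qed.

(** Evidence through a point with index [c] contains the core of type [c], hence
    is compatible with every arm of type [c]; so a believed point lies in all
    these arms, that is in the core. *)
Lemma flat_bel_forth (p q : N) : bel_E p q -> bel M p.1 q.1.
Proof.
case: q => x [c l] pq; have [j [jk jl _]] := fresh_layer p.2.2 l l.
suff [[_ rx]|[/esym //]] : arm4 p c j (x, (c, l)).
  exact: pleq_bel rx (r_bel _ _).
pose q : N := (r p.1 c, (c, p.2.2)).
apply: (@bel_E_closed _ N p _ _ q pq); first exact: arm4_evid.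
  by left; split=> //; apply: pleq_refl.
move=> R [->//|[c' [_ Rc Rr _]]] Rx.
by move: (Rc _ Rx) Rr => /= <- Rr; apply/Rr; apply: pleq_refl.
Qed.

Lemma flat_pmorphic : pmorphic_image M (intended N).
Proof.
apply: layered_pmorphic => [||||p x px].
- exact: flat_evid_up.
- exact: flat_evid_sep.
- exact: flat_bel_forth.
- move=> p Y pY; have [b Yb pb] := flatM pY.
  exists [set q | [/\ q.2.1 = b, Y q.1 & q.2.2 = p.2.2 -> pleq M b q.1]].
    right; exists b; split=> /=.
    + move=> x y l xy [lb Yx bx]; split=> //; first exact: (pleq_evid xy Yx pY).
      by move=> /bx /pleq_trans; apply.
    + by move=> q [].
    + move=> x; rewrite r_id //; split=> [[_ _]|bx]; first exact.
      by split=> //; apply: (pleq_evid bx Yb pY).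
    + exists Y => // x Yx; have [j [jk _ _]] := fresh_layer p.2.2 p.2.2 p.2.2.
      by exists (x, (b, j)).
  by move=> _ [q [_ Yq _] <-].
- by have := flat_bel_core p x; rewrite r_id //; exists (x, p.2.2).
Qed.

Lemma flat_flat : flat (intended N).
Proof.
move=> p S pS; suff [c Sc] : exists c, S (r p.1 c, (c, p.2.2)).
  by exists (r p.1 c, (c, p.2.2)) => //; apply: flat_bel_core.
case: pS => [->|[c [_ _ Sr _]]]; first by exists p.1.
by exists c; apply/Sr; apply: pleq_refl.
Qed.

End Bel.
End Flat.

(** * Arbitrary and uniform models *)

Lemma fset_bound (T : choiceType) (F : {fset T}) (P : T -> nat -> Prop) :
    (forall t, t \in F -> exists m0, forall m, m0 <= m -> P t m) ->
  exists m0, forall t m, t \in F -> m0 <= m -> P t m.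
Proof.
move=> FP; have [t|f fP] := @choice _ _ (fun t m0 =>
    t \in F -> forall m, m0 <= m -> P t m).
  have [/FP[m0 m0P]|] := boolP (t \in F); first by exists m0.
  by exists 0.
exists (\max_(t <- F) f t) => t m tF Fm; apply: fP => //.
by apply: leq_trans Fm; apply: leq_bigmax_seq.
Qed.

Lemma parity_above (k m : nat) : exists m', k < m' /\ odd m' = odd m.
Proof.
exists (odd m + k.+1.*2); rewrite oddD odd_double addbF oddb; split=> //.
by rewrite (leq_trans _ (leq_addl _ _)) // -addnn leq_addr.
Qed.

Section General.
Variables (At : Type) (M : eb_model At) (D : Type) (d0 : D).
Local Notation W := (M * (D * nat))%type.
(* The core of [b] at [p] is placed in layer [(i b, n p)].  The two instances are
   [i = id], [n p = p.2.2] for arbitrary models, which separates all cores, and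
   constant [i] and [n] for uniform ones, which keep evidence constant. *)
Variables (i : M -> D) (n : W -> nat).
(* If the cores of [b] and [c] meet, that of [c] contains the root of that of
   [b]; by symmetry they then coincide. *)
Hypothesis i_cone : forall w x b c, bel M w b -> bel M w c ->
  pleq M b x -> pleq M c x -> i b = i c -> pleq M c b.
Hypothesis n_avoid : uniform M \/
  forall m m', exists p, n p <> m /\ n p <> m'.

(** What lets the prongs of [b] exclude all evidence omitting the root of the
    core of [b]. *)
Definition core_closed (p : W) (S : set W) : Prop :=
  forall b x, bel M p.1 b -> pleq M b x ->
    S (x, (i b, n p)) -> S (b, (i b, n p)).

(** What makes a finite intersection of evidence meet all tails. *)
Definition persistent (S : set W) : Prop :=
  forall x d m, S (x, (d, m)) ->
    exists m0, forall m', m0 <= m' -> S (x, (d, m')).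

Definition regular (p : W) (S : set W) : Prop :=
  [/\ up_closed S, persistent S, core_closed p S & evid M p.1 (fst @` S)].

(** The parities keep the two prongs of [b] disjoint off the core, while both
    have points in late layers. *)
Definition arm (p : W) (b : M) (e : bool) : set W :=
  prong b (i b, n p) [set l | l.2 <> n p /\ odd l.2 = e].

Definition tail_evid (p : W) (S : set W) : Prop :=
  regular p S \/ exists b e, bel M p.1 b /\ S = arm p b e.

Lemma arm_full p b e x : exists l, arm p b e (x, l).
Proof.
have [m [nm me]] := parity_above (n p) e.
exists (i b, m); right; rewrite /= me oddb; split=> // mn.
by rewrite mn ltnn in nm.
Qed.

Lemma regular_full p S : up_closed S -> persistent S -> core_closed p S ->
  (forall x, exists l, S (x, l)) -> regular p S.
Proof.
move=> ? ? ? /full_image S_full; split; rewrite ?S_full //.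
exact: evid_setT.
Qed.

(** Unions of layers are trivially closed, also for the cores, as a core lies in
    a single layer; this provides the tails and the sets omitting a layer. *)
Lemma regular_layers p (Z : set (D * nat)) :
    (exists m0, forall d m, m0 <= m -> Z (d, m)) ->
  regular p [set q | Z q.2].
Proof.
move=> [m0 Zm]; apply: regular_full => //.
  by move=> x d m _; exists m0 => m' m0m'; apply: Zm.
by move=> x; exists (d0, m0); apply: Zm.
Qed.

Lemma tail_evid_setT p : tail_evid p setT.
Proof. by left; apply: (@regular_layers p setT); exists 0. Qed.

Lemma tail_evid_img p S : tail_evid p S ->
  exists2 Y, evid M p.1 Y & Y `<=` fst @` S.
Proof.
case=> [[_ _ _ pS]|[b [e [_ ->]]]]; first by exists (fst @` S).
by exists setT; rewrite ?full_image //; [apply: evid_setT|apply: arm_full].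
Qed.

Lemma tail_evid_up p S : tail_evid p S -> up_closed S.
Proof. by case=> [[]|[b [e [_ ->]]]] //; apply: prong_up. Qed.

Lemma tail_evid_core p S : tail_evid p S -> core_closed p S.
Proof.
case=> [[]//|[b [e [pb ->]]]] c x pc cx.
case=> [[/= [icb] bx]|[/= /(_ erefl)//]].
by left; split; rewrite /= ?icb //; apply: (i_cone pc pb cx bx).
Qed.

Lemma above_at_layer x l l' y m : l.2 < m -> l'.2 < m ->
  forall d : D, @above_at _ M (D * nat) x l l' (y, (d, m)).
Proof. by move=> lm lm' d [] /= e; move: lm lm'; rewrite -e /= ltnn. Qed.

(** The separating set is closed for the cores at a world whose core layers it
    contains; in a uniform model it is so everywhere, since cores are
    clusters. *)
Lemma tail_evid_sep x l l' : exists p,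
  exists2 S, tail_evid p S /\ S (x, l) & S `<=` above_at x l l'.
Proof.
suff [p pS] : exists p, core_closed p (above_at x l l').
  exists p, (above_at x l l') => //; split; last by move=> _; apply: pleq_refl.
  pose m0 := (maxn l.2 l'.2).+1.
  have above m y d : m0 <= m -> above_at x l l' (y, (d, m)).
    by rewrite /m0 gtn_max => /andP[lm lm']; apply: above_at_layer.
  left; apply: regular_full => //; first exact: above_at_up.
    by move=> y d m _; exists m0 => m'; apply: above.
  by move=> y; exists (d0, m0); apply: above.
case: n_avoid => [[_ _ maxM]|/(_ l.2 l'.2)[p [nl nl']]].
  exists (x, l) => b y pb yb; apply: above_at_up.
  exact: maxM pb _ yb.
by exists p => b y _ _ _ [] /= e; [case: nl|case: nl']; rewrite -e.
Qed.

Lemma tail_evid_layer l : exists p, tail_evid p [set q | q.2 <> l].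
Proof.
have [x _] := world_neq0 M; exists (x, l); left.
apply: (@regular_layers _ [set k | k <> l]); exists l.2.+1 => d m lm e.
by rewrite -e ltnn in lm.
Qed.

Definition tail_layered : evidence_model At :=
  layered (d0, 0) tail_evid_setT tail_evid_img.
Local Notation N := tail_layered.

(** Suppose [x] is not believed.  A prong through [(x, (d, m))] then contains it
    outside its core, hence with all late layers of the parity of [m]; so do
    the regular sets.  Finitely many of them meet the tail beyond [m], which
    omits [(x, (d, m))]. *)
Lemma tail_bel_forth (p q : N) : bel_E p q -> bel M p.1 q.1.
Proof.
case: q => x [d m] /bel_EP pq; apply: contrapT => /= npx.
have [|/= |F FP Ftail] := pq [set q | m < q.2.2].
- by left; apply: (@regular_layers _ [set l | m < l.2]); exists m.+1.
- by rewrite ltnn.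
have [R /FP[pR Rx]|m0 m0P] := @fset_bound _ F (fun R m' =>
    odd m' = odd m -> R (x, (d, m'))).
  case: pR Rx => [[_ + _ _] Rx|[b [e [pb ->]]] [[_ bx]|[/= _ me]]].
  - by move=> /(_ _ _ _ Rx)[m0 m0P]; exists m0 => m' /m0P.
  - by case: npx; apply: pleq_bel bx pb.
  exists (n p).+1 => m' nm' om'; right; rewrite /= om'; split=> // e'.
  by rewrite e' ltnn in nm'.
have [m' [mm' om']] := parity_above (maxn m m0) m.
move: mm'; rewrite gtn_max => /andP[mm' m0m'].
have [R RF] := Ftail (x, (d, m')) mm'.
by apply; apply: m0P => //; apply: ltnW.
Qed.

Lemma tail_bel_back (p : N) b : bel M p.1 b -> bel_E p ((b, (i b, n p)) : N).
Proof.
move=> pb; have pA e : tail_evid p (arm p b e) by right; exists b, e.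
apply: (bel_E_prong (pA true) (pA false)).
  by move=> l [[_ /= ->] []].
by move=> S x /tail_evid_core pS Sx bx; apply: pS Sx.
Qed.

Lemma tail_pmorphic : pmorphic_image M (intended N).
Proof.
apply: layered_pmorphic => [||||p x /tail_bel_back].
- exact: tail_evid_up.
- exact: tail_evid_sep.
- exact: tail_bel_forth.
- move=> p Y pY.
  (* Core layers are left out since [Y] may meet a core without containing it. *)
  exists [set q | Y q.1 /\ q.2.2 <> n p]; last first.
    by move=> _ [q [Yq _] <-].
  have big m : n p < m -> m <> n p by move=> + e; rewrite e ltnn.
  left; split.
  + by move=> x y l xy [/= Yx lp]; split=> //; apply: (pleq_evid xy Yx pY).
  + by move=> x d m [/= Yx _]; exists (n p).+1 => m' /big.
  + by move=> b x _ _ [].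
  + suff -> : fst @` [set q : W | Y q.1 /\ q.2.2 <> n p] = Y by [].
    apply/seteqP; split=> [_ [q [Yq _] <-]//|x Yx].
    by exists (x, (d0, (n p).+1)) => //; split=> //; apply: big.
- by exists (i x, n p).
Qed.

Lemma tail_uniform : (forall p q, n p = n q) ->
  uniform M -> uniform (intended N).
Proof.
move=> n_const uM; apply: layered_uniform => //.
- exact: tail_evid_up.
- exact: tail_evid_sep.
- exact: tail_bel_forth.
- exact: tail_evid_layer.
have [evM belM _] := uM => p q; apply/funext => S.
rewrite /tail_evid /regular /core_closed /arm (evM p.1 q.1) (belM p.1 q.1).
by rewrite (n_const p q).
Qed.

End General.

(** * Representation *)

Lemma pmorphic_representation (At : Type) (M : eb_model At) :
  exists N : evidence_model At, pmorphic_image M (intended N).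
Proof.
have [x0 _] := world_neq0 M.
exists (tail_layered (M := M) x0 id (fun p => p.2.2)); apply: tail_pmorphic.
  by move=> w x b c _ _ _ _ ->; apply: pleq_refl.
right=> m m'; exists (x0, (x0, (maxn m m').+1)) => /=.
split=> e; first by have := leq_maxl m m'; rewrite -ltnS e ltnn.
by have := leq_maxr m m'; rewrite -ltnS e ltnn.
Qed.

Lemma uniform_representation (At : Type) (M : eb_model At) : uniform M ->
  exists N : evidence_model At,
    pmorphic_image M (intended N) /\ uniform (intended N).
Proof.
move=> uM; have [_ _ maxM] := uM.
have i_cone : forall w x b c, bel M w b -> bel M w c ->
    pleq M b x -> pleq M c x -> tt = tt -> pleq M c b.
  by move=> w x b c /maxM b_max _ /b_max xb cx _; apply: pleq_trans cx xb.
exists (tail_layered (M := M) tt (fun=> tt) (fun=> 0)); split.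
  by apply: tail_pmorphic => //; left.
by apply: tail_uniform => //; left.
Qed.

Lemma flat_representation (At : Type) (M : eb_model At) : flat M ->
  exists N : evidence_model At, [/\ pmorphic_image M (intended N),
    flat (intended N) & finite_model M -> finite_model N].
Proof.
move=> flatM; have [x0 _] := world_neq0 M.
have [wc|r rP] := @choice _ _ (fun (wc : M * M) b =>
    bel M wc.1 b /\ (bel M wc.1 wc.2 -> b = wc.2)).
  have [b _ wb] := flatM wc.1 _ (evid_setT (e := M) wc.1).
  by have [wc2|nwc] := pselect (bel M wc.1 wc.2); [exists wc.2|exists b].
have r_bel w c : bel M w (r (w, c)) by case: (rP (w, c)).
have r_id w c : bel M w c -> r (w, c) = c by case: (rP (w, c)).
exists (flat_layered (fun w c => r (w, c)) x0); split.
- exact: flat_pmorphic.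
- exact: flat_flat.
move=> fM; apply: layered_finite => //.
by rewrite -setXTT; apply: finite_setX => //; apply: finite_layer4.
Qed.

Lemma concise_representation (At : Type) (M : eb_model At) : concise M ->
  exists N : evidence_model At, [/\ pmorphic_image M (intended N),
    concise (intended N) & finite_model M -> finite_model N].
Proof.
move=> cM; exists (concise_layered M); split.
- exact: concise_pmorphic.
- exact: concise_concise.
- by apply: layered_finite; apply: finite_layer4.
Qed.

Theorem theorem4 (At : Type) (lambda : logic) (M : eb_model At)
    (hM : lambda_model lambda M) :
  (exists N : evidence_model At, pmorphic_image M (intended N)) /\
  (flat M /\ finite_model M ->
     exists N : evidence_model At,
       pmorphic_image M (intended N) /\ flat (intended N) /\ finite_model N) /\
  (flat M ->
     exists N : evidence_model At,
       pmorphic_image M (intended N) /\ flat (intended N)) /\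
  (uniform M ->
     exists N : evidence_model At,
       pmorphic_image M (intended N) /\ uniform (intended N)) /\
  (finite_model M /\ concise M ->
     exists N : evidence_model At,
       pmorphic_image M (intended N) /\
       finite_model N /\ concise (intended N)).
Proof.
split; first exact: pmorphic_representation.
split=> [[/flat_representation[N [pN fN finN]] /finN finiteN]|].
  by exists N.
split=> [/flat_representation[N [pN fN _]]|]; first by exists N.
split; first exact: uniform_representation.
by move=> [finM /concise_representation[N [pN cN /(_ finM)]]]; exists N.
Qed.
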